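(* Let $K$ be a field of prime characteristic $p$ and let $L/K$ be a finite field extension. Then $(L/K)_{nor}=L^{G(L/K)}_{dif}$.
   Context: For a finite field extension $L/K$: $G(L/K)=\mathrm{Aut}_{K\text{-alg}}(L)$ and $L^{G(L/K)}$ is its fixed field. $\mathcal{D}(L/K)=\bigcup_{i\ge0}\mathcal{D}_i\subseteq\mathrm{End}_K(L)$ is the algebra of $K$-linear differential operators on $L$, where $\mathcal{D}_0=L$ (acting by multiplication) and $\mathcal{D}_i=\{\delta\in\mathrm{End}_K(L)\mid\delta l-l\delta\in\mathcal{D}_{i-1}\text{ for all }l\in L\}$. $L_{dif}=\{l\in L\mid l\delta=\delta l\text{ for all }\delta\in\mathcal{D}(L/K)\}$ and $L^{G(L/K)}_{dif}:=L^{G(L/K)}\cap L_{dif}$. An intermediate field $M$ of $L/K$ is called a co-normal subfield if the field extension $L/M$ is normal. $(L/K)_{nor}$ denotes the least (with respect to inclusion) co-normal subfield of $L/K$; thus the claim asserts that $L^{G(L/K)}_{dif}$ is a co-normal subfield that is contained in every co-normal subfield. *)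

(* Defs.v *)
From mathcomp Require Import all_boot all_order all_algebra all_field.
Set Implicit Arguments.
Unset Strict Implicit.
Unset Printing Implicit Defensive.
Import GRing.Theory.
Local Open Scope ring_scope.

Section Definitions.
Variables (K : fieldType) (L : fieldExtType K).
Implicit Types (M N : {subfield L}) (f d : 'End(L)) (x l : L).

Fixpoint diffop_ord (i : nat) d : Prop :=
  if i is j.+1 then
    forall l, diffop_ord j ((d \o amull l)%VF - (amull l \o d)%VF)
  else exists l, d = amull l.

Definition diffop d : Prop := exists i, diffop_ord i d.

(* [kAut 1 {:L}] is the set of K-algebra automorphisms of L. *)
Definition fixed_aut x : Prop := forall f, kAut 1 {:L} f -> f x = x.

Definition comm_diffop x : Prop :=
  forall d, diffop d -> (amull x \o d)%VF = (d \o amull x)%VF.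

Definition dif_fixed x : Prop := fixed_aut x /\ comm_diffop x.

(* The extension L/M is normal. The library's [normalField] does not apply:
   it is relative to an ambient splitting field, and L/K need not be normal. *)
Definition conormal M : Prop :=
  forall (q : {poly subvs_of M}) x,
    irreducible_poly q -> root (map_poly vsval q) x ->
    exists rs : seq L, map_poly vsval q %= \prod_(r <- rs) ('X - r%:P).

Definition is_nor M : Prop :=
  conormal M /\ forall N, conormal N -> (M <= N)%VS.

End Definitions.

(* Main.v *)
(** Let S be the separable closure of K in L; then D(L/K) = End_S(L), so that
    L_dif = S. An element x of S commutes with every operator d because, by
    induction on the order of d, [d, x] commutes with x and hence
    0 = [d, g(x)] = g'(x) [d, x] for the minimal polynomial g of x. Conversely
    S-linear endomorphisms are differential operators since L/S is purely
    inseparable and, in characteristic p, (ad l)^q = ad (l^q) for q a power of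
    p; an S-linear retraction of L onto S then detects the elements outside S.

    Put M = S^G, with G = Aut(L/K). The orbit polynomial of x in L raised to a
    large power of p has coefficients in M and splits in L, so L/M is normal.
    If L/N is normal and x in S is not in N, some N-automorphism of L moves x to
    another root of its minimal polynomial over N; hence M is contained in N. *)
Require Import Defs.
From HB Require Import structures.
From mathcomp Require Import all_boot all_order all_algebra all_field.
From Stdlib Require Import Classical_Prop.
From mathcomp Require Import ring.
Set Implicit Arguments.
Unset Strict Implicit.
Unset Printing Implicit Defensive.
Import GRing.Theory.
Local Open Scope ring_scope.

(** * Iterated commutators and the order of an operator *)

Section Commutators.
Variables (K : fieldType) (L : fieldExtType K).
Implicit Types (d : 'End(L)) (l x u : L).

Definition ad l d : 'End(L) := ((d \o amull l) - (amull l \o d))%VF.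

Lemma ad_apply l d u : ad l d u = d (l * u) - l * d u.
Proof. by rewrite /ad !lfun_simp. Qed.

Lemma adC l x d : ad l (ad x d) = ad x (ad l d).
Proof. by apply/lfunP => u; rewrite !ad_apply [l * (x * u)]mulrCA; ring. Qed.

Lemma ad0 l : ad l 0 = 0.
Proof. by apply/lfunP => u; rewrite ad_apply !lfunE /= mulr0 subr0. Qed.

Lemma iter_adC l x d n : iter n (ad l) (ad x d) = ad x (iter n (ad l) d).
Proof. by elim: n => //= n ->; rewrite adC. Qed.

Lemma iter_ad0 l n : iter n (ad l) 0 = 0.
Proof. by elim: n => //= n ->; rewrite ad0. Qed.

Lemma ad_sumr (I : finType) (c : I -> K) (b : I -> L) d :
  ad (\sum_i c i *: b i) d = \sum_i c i *: ad (b i) d.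
Proof.
apply/lfunP => u; rewrite ad_apply sum_lfunE mulr_suml.
rewrite (linear_sum d) mulr_suml -sumrB; apply: eq_bigr => i _.
by rewrite scale_lfunE ad_apply scalerBr -!scalerAl linearZ.
Qed.

Lemma adD l d d' : ad l (d + d') = ad l d + ad l d'.
Proof.
apply/lfunP => u; rewrite add_lfunE !ad_apply !add_lfunE.
by generalize (d (l * u)) (d' (l * u)) (d u) (d' u) => a b c e; ring.
Qed.

Lemma adZ l (c : K) d : ad l (c *: d) = c *: ad l d.
Proof.
by apply/lfunP => u; rewrite scale_lfunE !ad_apply !scale_lfunE scalerBr scalerAr.
Qed.

(* The commutator with [x] is the action of ['X - x] on ['End(L)], where
   coefficients act on the left and ['X] acts by right composition with [x]. *)
Lemma iter_adE n x d u :
  iter n (ad x) d u = \sum_(i < n.+1) (('X - x%:P) ^+ n)`_i * d (x ^+ i * u).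
Proof.
elim: n u => [|n IHn] u; first by rewrite big_ord1 coefC /= !mul1r.
rewrite /= ad_apply !IHn; set P := _ ^+ n.
have Pn : P`_n.+1 = 0 by rewrite nth_default // size_exp_XsubC.
transitivity (\sum_(i < n.+2) (('X * P)`_i - x * P`_i) * d (x ^+ i * u)).
  under [RHS]eq_bigr do rewrite mulrBl; rewrite sumrB; congr (_ - _).
    rewrite [RHS]big_ord_recl coefXM mul0r add0r; apply: eq_bigr => i _.
    by rewrite coefXM /= /bump /= add1n exprSr mulrA.
  rewrite [RHS]big_ord_recr /= Pn mulr0 mul0r addr0 mulr_sumr.
  by apply: eq_bigr => i _; rewrite mulrA.
by apply: eq_bigr => i _; rewrite -coefCM -coefB -mulrBl -exprS.
Qed.

Lemma iter_ad_pchar n x d : [pchar L].-nat n -> iter n (ad x) d = ad (x ^+ n) d.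
Proof.
move=> charLn; apply/lfunP => u; rewrite iter_adE ad_apply.
have charPn : [pchar {poly L}].-nat n by rewrite (eq_pnat _ (pchar_poly L)).
rewrite exprDn_pchar // exprNn_pchar // -polyC_exp; case: n charLn {charPn} => // n _.
rewrite big_ord_recr big_ord_recl big1 => [|i _] /=.
  by rewrite !coefB !coefXn !coefC eqxx /= subr0 sub0r mul1r addr0 mulNr mul1r addrC.
by rewrite coefB coefXn coefC /bump /= add1n eqSS ltn_eqF // subrr mul0r.
Qed.

Lemma diffop_ord0 i : diffop_ord i (0 : 'End(L)).
Proof.
elim: i => [|i IHi] /=; first by exists 0; rewrite linear0.
by move=> l; rewrite -/(ad l 0) ad0.
Qed.

Lemma diffop_ordD i d d' :
  diffop_ord i d -> diffop_ord i d' -> diffop_ord i (d + d').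
Proof.
elim: i d d' => [|i IHi] d d' /=.
  by case=> l -> [l' ->]; exists (l + l'); rewrite linearD.
by move=> dP d'P l; rewrite -/(ad l _) adD; apply: IHi; [apply: dP | apply: d'P].
Qed.

Lemma diffop_ordZ i (c : K) d : diffop_ord i d -> diffop_ord i (c *: d).
Proof.
elim: i d => [|i IHi] d /=; first by case=> l ->; exists (c *: l); rewrite linearZ.
by move=> dP l; rewrite -/(ad l _) adZ; apply/IHi/dP.
Qed.

(** Induction on the sum of [e]: a commutator with any [l] is a combination of commutators with
    basis vectors, each of which lowers one exponent; since the maps [ad] commute, the other
    nilpotency conditions persist. *)
Lemma diffop_nilpotent (e : 'I_(\dim {:L}) -> nat) d :
  (forall j, iter (e j) (ad (vbasis {:L})`_j) d = 0) ->
  diffop_ord (\sum_j e j)%N d.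
Proof.
move Dn: (\sum_j e j)%N => n; elim: n e Dn d => [|n IHn] e Dn d d0.
  (* All exponents vanish here; as [L] has positive dimension there is an index [j], and its
     hypothesis reads [d = 0]. *)
  pose j := Ordinal (adim_gt0 {:L}); have := d0 j.
  have /eqP -> : e j == 0%N.
    by move/eqP: Dn; rewrite sum_nat_eq0 => /forallP/(_ j)/implyP; apply.
  by move=> /= ->; apply: (diffop_ord0 0).
move=> l; rewrite -/(ad l d) (coord_vbasis (memvf l)) ad_sumr.
elim/big_ind: _ => [||j _]; [exact: diffop_ord0 | exact: diffop_ordD |].
apply: diffop_ordZ; have [e0|e_gt0] := posnP (e j).
  by have := d0 j; rewrite e0 /= => ->; rewrite ad0; apply: diffop_ord0.
apply: (IHn (fun i => e i - (i == j))%N) => [|i].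
  rewrite (bigD1 j) //= eqxx; move: Dn; rewrite (bigD1 j) //=.
  under [X in _ -> (_ + X)%N = _]eq_bigr => i /negPf-> do rewrite subn0.
  by case: (e j) e_gt0 => // m _ [<-]; rewrite subSS subn0.
have [->|_] := eqVneq i j; last by rewrite subn0 iter_adC d0 ad0.
by rewrite -iterSr subn1 prednK.
Qed.

End Commutators.

(** * Differential operators and the separable closure *)

Section SeparableClosure.
Variables (K : fieldType) (L : fieldExtType K).
Implicit Types (S : {subfield L}) (d : 'End(L)) (x u : L).

(** Each basis vector [b] has a power [b ^+ n] in [S] with [n] as in [iter_ad_pchar]; its [n]-fold
    commutator is [ad (b ^+ n) d], which [S]-linearity kills. *)
Lemma purely_inseparable_diffop S d :
  purely_inseparable S {:L} -> {in S, forall s u, d (s * u) = s * d u} ->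
  diffop d.
Proof.
move=> /purely_inseparableP insepS dS.
have /fin_all_exists[e eP] (j : 'I_(\dim {:L})) :
    exists n, iter n (ad (vbasis {:L})`_j) d = 0.
  have /purely_inseparable_elementP_pchar[n charn Sn] :=
    insepS (vbasis {:L})`_j (memvf _).
  by exists n; rewrite iter_ad_pchar //; apply/lfunP => u;
    rewrite ad_apply dS // subrr lfunE.
by exists (\sum_j e j)%N; apply: diffop_nilpotent.
Qed.

Lemma subfield_retraction S : exists d : 'End(L),
  [/\ {in S, forall s u, d (s * u) = s * d u}, d 1 = 1 & forall u, d u \in S].
Proof.
(* Over [S] as base field, the line spanned by 1 is [S] itself, and any linear projection onto it
   serves. *)
pose V : {vspace fieldOver S} := 1%VS; pose f (u : L) : L := projv V u.
have fS : {in S, forall s u, f (s * u) = s * f u}.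
  by move=> s Ss u; rewrite /f -[s](vsprojK Ss) -!fieldOver_scaleE linearZ.
have f_lin : linear f.
  move=> c u v; rewrite -mulr_algl.
  have -> : f (c%:A * u + v) = f (c%:A * u) + f v by apply: (raddfD (projv V)).
  by rewrite fS ?memvZ ?mem1v // mulr_algl.
exists (linfun (HB.pack f (GRing.isLinear.Build _ _ _ _ f f_lin) : {linear L -> L})).
split=> [s Ss u | | u]; rewrite ?lfunE; first exact: fS.
  by apply: (projv_id (U := V)); rewrite trivial_fieldOver; apply: (mem1v S).
by rewrite -trivial_fieldOver; apply: (memv_proj V).
Qed.

(** Evaluating at 1 the commutation of [x] with a retraction [d] onto the separable closure gives
    [x = d x]. *)
Lemma comm_diffop_separable x : comm_diffop x -> separable_element 1 x.
Proof.
move=> xC; pose S := <<1; separable_generator 1 {:L}>>%AS.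
have [d [dS d1 S_d]] := subfield_retraction S.
have dP := purely_inseparable_diffop (separable_generator_maximal {:L} 1) dS.
have := xC d dP => /lfunP/(_ 1); rewrite !lfun_simp /= d1 !mulr1 => ->.
exact: (adjoin_separableP (separable_generatorP {:L} 1)).
Qed.

Lemma separable_comm_diffop x : separable_element 1 x -> comm_diffop x.
Proof.
move=> sep_x d [i]; suff: diffop_ord i d -> ad x d = 0.
  by move=> h /h/eqP; rewrite subr_eq0 => /eqP->.
elim: i d => [|i IHi] d /=.
  by case=> l ->; apply/lfunP => u; rewrite ad_apply !lfunE /= mulrCA subrr.
move=> /(_ x)/IHi adxx; pose e := ad x d.
have eE u : e (x * u) = x * e u.
  by apply/eqP; rewrite -subr_eq0 -ad_apply adxx lfunE.
have dE u : d (x * u) = x * d u + e u by rewrite /e ad_apply addrC subrK.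
(* A Leibniz rule, valid because [e] commutes with [x]; at [n = 0] the factor [*+ n] cancels the
   spurious [n.-1]. *)
have dX n u : d (x ^+ n * u) = x ^+ n * d u + x ^+ n.-1 *+ n * e u.
  elim: n u => [|n IHn] u; first by rewrite !mul1r mulr0n mul0r addr0.
  rewrite exprSr -mulrA IHn dE eE mulrDr !mulrA -addrA; congr (_ + _).
  case: n {IHn} => [|n] /=; first by rewrite mulr0n !mul0r addr0.
  by rewrite [_ *+ _ * x]mulrnAl -exprSr [in RHS]mulrS mulrDl.
pose g := minPoly 1 x.
(* The rule extends [K]-linearly from powers of [x] to the value at [x] of its minimal
   polynomial. *)
have dg u : d (g.[x] * u) = g.[x] * d u + g^`().[x] * e u.
  have /polyOver1P[h Dg] := minPolyOver 1 x.
  have gE : g.[x] = \sum_(k < size h) h`_k *: x ^+ k.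
    rewrite /g Dg horner_coef size_map_poly; apply: eq_bigr => k _.
    by rewrite coef_map mulr_algl.
  have g'E : g^`().[x] = \sum_(k < size h) h`_k *: (x ^+ k.-1 *+ k).
    rewrite /g Dg /deriv horner_poly size_map_poly.
    case: (size h) => [|m] /=; first by rewrite !big_ord0.
    rewrite [RHS]big_ord_recl mulr0n scaler0 add0r; apply: eq_bigr => k _.
    by rewrite coef_map /= mulrnAl mulr_algl scalerMnr.
  rewrite gE g'E !mulr_suml linear_sum -big_split; apply: eq_bigr => k _ /=.
  by rewrite -!scalerAl linearZ /= dX scalerDr.
have g'x : g^`().[x] != 0.
  by have := separable_root_der 1 x; rewrite sep_x.
apply/lfunP => u; rewrite -/e zero_lfunE.
have /esym/eqP := dg u; rewrite /g minPolyxx !mul0r linear0 add0r mulf_eq0.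
by rewrite (negPf g'x) => /eqP.
Qed.

End SeparableClosure.

(** * Finite sets and subspaces cut out by undecidable predicates *)

Lemma finite_root_pred (R : idomainType) (p : {poly R}) (P : R -> Prop) :
    p != 0 -> (forall y, P y -> root p y) ->
  exists2 s : seq R, uniq s & forall y, y \in s <-> P y.
Proof.
(* The fuel [n] bounds how often [s] can still grow: a nonzero [p] has fewer than [size p] roots. *)
move=> nz_p rootP; suff ext n (s : seq R) : (size p <= size s + n)%N -> uniq s ->
    (forall y, y \in s -> P y) -> exists2 s', uniq s' & forall y, y \in s' <-> P y.
  by apply: (ext (size p) [::]).
elim: n s => [|n IHn] s le_p_s Us sP.
  have /(max_poly_roots nz_p)/(_ Us) : all (root p) s.
    by apply/allP => y /sP/rootP.
  by rewrite ltnNge -[size s]addn0 le_p_s.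
have [[y [Py s'y]] | noy] := classic (exists y, P y /\ y \notin s).
  apply: (IHn (y :: s)); rewrite /= ?s'y ?addSnnS // => z.
  by rewrite inE => /predU1P[->|/sP].
exists s => // y; split=> [/sP//|Py].
by apply/negPn/negP => s'y; apply: noy; exists y.
Qed.

(** A subspace inside [P] is enlarged by one vector at a time; the codimension bounds the number of
    steps. *)
Lemma vspace_pred (F : fieldType) (V : vectType F) (P : V -> Prop) :
    P 0 -> (forall (c : F) u v, P u -> P v -> P (c *: u + v)) ->
  exists W : {vspace V}, forall x, x \in W <-> P x.
Proof.
move=> P0 Plin; suff ext n (W : {vspace V}) : (\dim {:V} <= \dim W + n)%N ->
    (forall x, x \in W -> P x) -> exists W' : {vspace V}, forall x, x \in W' <-> P x.
  by apply: (ext (\dim {:V}) 0%VS) => [|x]; rewrite ?leq_addl // memv0 => /eqP->.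
elim: n W => [|n IHn] W leVW WP.
  exists W => x; split=> [/WP//|_]; suff -> : W = fullv by rewrite memvf.
  by apply/eqP; rewrite eqEdim subvf -[X in (_ <= X)%N]addn0.
have [[x [Px W'x]] | nox] := classic (exists x, P x /\ x \notin W).
  apply: (IHn (<[x]> + W)%VS) => [|y].
    apply: leq_trans leVW _; rewrite -addSnnS leq_add2r.
    rewrite ltnNge; apply: contra W'x => le_dim.
    have /eqP eqW : W == (<[x]> + W)%VS by rewrite eqEdim addvSr.
    by rewrite memvE eqW addvSl.
  by case/memv_addP=> _ /vlineP[c ->] [w /WP Pw ->]; apply: Plin.
exists W => x; split=> [/WP//|Px].
by apply/negPn/negP => W'x; apply: nox; exists x.
Qed.

Lemma subfield_pred (F : fieldType) (L : fieldExtType F) (P : L -> Prop) :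
    P 1 -> (forall (c : F) u v, P u -> P v -> P (c *: u + v)) ->
    (forall u v, P u -> P v -> P (u * v)) ->
  exists M : {subfield L}, forall x, x \in M <-> P x.
Proof.
move=> P1 Plin PM; have P0 : P 0 by have := Plin (-1) 1 1 P1 P1; rewrite scaleN1r addNr.
have [W WP] := vspace_pred P0 Plin.
have W_as : is_aspace W.
  rewrite /is_aspace has_algid1; last exact/WP.
  by apply/prodvP => u v /WP Pu /WP Pv; apply/WP/PM.
by exists (ASpace W_as).
Qed.

Lemma exp_prod_XsubC (R : comNzRingType) (s : seq R) n :
  (\prod_(r <- s) ('X - r%:P)) ^+ n = \prod_(r <- flatten (nseq n s)) ('X - r%:P).
Proof.
elim: n => [|n IHn] /=; first by rewrite big_nil.
by rewrite exprS IHn big_cat.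
Qed.

(** * Automorphisms and co-normal subfields *)

Section Conormal.
Variables (K : fieldType) (L : fieldExtType K).
Implicit Types (M N : {subfield L}) (f : 'End(L)) (x y : L).

Lemma kAut_separable f x :
  kAut 1 {:L} f -> separable_element 1 x -> separable_element 1 (f x).
Proof.
case/andP=> homf _ sep_x; apply/separable_elementP; exists (minPoly 1 x).
rewrite minPolyOver; split=> //.
exact: kHom_root_id (sub1v _) homf (minPolyOver 1 x) (memvf x) (root_minPoly 1 x).
Qed.

(** An element separable over [K] is both separable and purely inseparable over the separable
    closure, hence lies in it. *)
Lemma separable_elementE x :
  separable_element 1 x = (x \in <<1; separable_generator 1 {:L}>>%VS).
Proof.
apply/idP/idP=> [sep_x|]; last first.
  exact: (adjoin_separableP (separable_generatorP {:L} 1)).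
rewrite -separable_inseparable_element (separable_elementS _ sep_x) ?sub1v //.
by have /purely_inseparableP := separable_generator_maximal {:L} 1; apply; rewrite memvf.
Qed.

Lemma fixed_separable_subfield :
  exists M, forall x, x \in M <-> fixed_aut x /\ separable_element 1 x.
Proof.
apply: subfield_pred => [|c u v [Fu Su] [Fv Sv]|u v [Fu Su] [Fv Sv]].
- split=> [f /andP[/kHomP_tmp[f1 _] _]|]; first by rewrite f1 ?mem1v.
  by rewrite base_separable ?mem1v.
- split=> [f autf|]; first by rewrite linearP /= Fu ?Fv.
  by rewrite !separable_elementE in Su Sv *; rewrite memvD ?memvZ.
- split=> [f autf|]; last by rewrite !separable_elementE in Su Sv *; rewrite memvM.
  by have /andP[/kHomP_tmp[_ fM] _] := autf; rewrite fM ?memvf // Fu ?Fv.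
Qed.

(* For the orbit [s] of [x] under [Aut(L/K)] and [n] a power of [p] with [x ^+ n]
   separable, the polynomial [\prod_(y <- s) ('X - y) ^+ n] has coefficients in [M]. *)
Lemma fixed_separable_conormal M :
    (forall x, x \in M <-> fixed_aut x /\ separable_element 1 x) -> conormal M.
Proof.
move=> MP q x [q_gt1 q_irr] qx0.
pose orb y := exists2 f, kAut 1 {:L} f & y = f x.
have nz_m : minPoly 1 x != 0 by rewrite monic_neq0 ?monic_minPoly.
have [y [f /andP[homf _] ->]|s Us sP] := @finite_root_pred _ _ orb nz_m.
  exact: kHom_root_id (sub1v _) homf (minPolyOver 1 x) (memvf x) (root_minPoly 1 x).
have [n /andP[charn sep_xn]] := separable_exponent_pchar 1 x.
pose h := (\prod_(y <- s) ('X - y%:P)) ^+ n.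
have h_sep i : separable_element 1 h`_i.
  rewrite separable_elementE; apply: polyOverP i; rewrite /h -prodrXl big_seq.
  (* The factor of [f x] is ['X^n] minus the constant [f (x ^+ n)], a conjugate of a separable
     element. *)
  apply: rpred_prod => y /sP[f autf ->].
  have charPn : [pchar {poly L}].-nat n by rewrite (eq_pnat _ (pchar_poly L)).
  rewrite exprDn_pchar // exprNn_pchar // -polyC_exp rpredB ?rpredX ?polyOverX //.
  have /andP[homf _] := autf.
  have fmM := GRing.isMonoidMorphism.Build _ _ _ (elimT kHom_monoid_morphism homf).
  pose fRM : {rmorphism _ -> _} := HB.pack (fun_of_lfun f) fmM.
  rewrite polyOverC -separable_elementE -(rmorphXn fRM).
  exact: kAut_separable autf sep_xn.
have h_fixed f : kAut 1 {:L} f -> map_poly f h = h.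
  move=> autf; have /andP[homf _] := autf.
  have fmM := GRing.isMonoidMorphism.Build _ _ _ (elimT kHom_monoid_morphism homf).
  pose fRM : {rmorphism _ -> _} := HB.pack (fun_of_lfun f) fmM.
  have -> : map_poly f h = map_poly fRM h by [].
  rewrite rmorphXn; congr (_ ^+ n); apply: etrans (esym (prod_map_poly fRM s xpredT)) _.
  apply: perm_big.
  (* Being injective, [f] permutes the finite orbit [s]. *)
  have Ufs : uniq (map fRM s) by rewrite map_inj_uniq //; apply: fmorph_inj.
  have sfs : {subset map fRM s <= s}.
    move=> _ /mapP[y /sP[g autg ->] ->]; apply/sP; exists (f \o g)%VF.
      rewrite kAutfE; apply: comp_kHom => //; exact: kHom_kAut_sub autg.
    by rewrite comp_lfunE.
  have szs : (size s <= size (map fRM s))%N by rewrite size_map.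
  by apply: uniq_perm => //; have [] := uniq_min_size Ufs sfs szs.
have /polyOver_subvs[g Dg] : h \is a polyOver M.
  apply/polyOverP => i; apply/MP; split=> // f autf.
  by rewrite -[in RHS](h_fixed f autf) coef_map.
have hx0 : root h x.
  (* The exponent is positive by [charn], so [h] keeps the roots of its base. *)
  case: n charn @h {sep_xn h_sep h_fixed Dg} => // n _.
  rewrite /= /root horner_exp expf_eq0 /= -/(root _ x) root_prod_XsubC.
  by apply/sP; exists \1%VF; rewrite ?lfunE // kAutfE kHom1.
have q_dvd_g : q %| g.
  have /q_irr/(_ (dvdp_gcdl _ _)) : size (gcdp q g) != 1%N.
    rewrite -/(coprimep q g) -(coprimep_map (vsval : {rmorphism subvs_of M -> L})).
    apply/negP => /coprimep_root/(_ qx0); rewrite -Dg => /negP[].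
    exact: hx0.
  by move/eqp_dvdl <-; rewrite dvdp_gcdr.
have : map_poly vsval q %| h by rewrite Dg dvdp_map.
by rewrite /h exp_prod_XsubC => /dvdp_prod_XsubC[m Dq]; exists (mask m (flatten (nseq n s))).
Qed.

Lemma conormal_split N x : conormal N ->
  exists rs : seq L, minPoly N x %= \prod_(r <- rs) ('X - r%:P).
Proof.
move=> norN; have /polyOver_subvs[q Dq] := minPolyOver N x.
rewrite Dq; apply: (norN q x); last by rewrite -Dq root_minPoly.
split=> [|d d_neq1 d_dvd].
  by rewrite -(size_map_poly (vsval : {rmorphism subvs_of N -> L})) -Dq size_minPoly ltnS.
have Nd : map_poly vsval d \is a polyOver N by apply/polyOver_subvs; exists d.
have := minPoly_irr (x := x) Nd; rewrite Dq dvdp_map eqp_map => /(_ d_dvd)/orP[//|].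
by rewrite -size_poly_eq1 size_map_poly (negPf d_neq1).
Qed.

(** The product of the minimal polynomials of a basis splits, and its roots include that basis. *)
Lemma conormal_splittingField N : conormal N ->
  exists2 p : {poly L}, p \is a polyOver N & splittingFieldFor N p {:L}.
Proof.
move=> norN; pose b (j : 'I_(\dim {:L})) := (vbasis {:L})`_j.
have /fin_all_exists[rs rsP] j := conormal_split (b j) norN.
exists (\prod_j minPoly N (b j)).
  by apply: rpred_prod => j _; apply: minPolyOver.
exists (flatten (map rs (index_enum _))).
  rewrite big_flatten big_map.
  apply: (big_ind2 (fun u v : {poly L} => u %= v)) => [|u v u' v' uv u'v'|j _].
  - exact: eqpxx.
  - exact: eqp_trans (eqp_mulr _ uv) (eqp_mull _ u'v').
  - exact: rsP.
apply/eqP; rewrite eqEsubv subvf /=.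
apply: (@subv_trans _ _ <<vbasis {:L}>>%VS).
  by rewrite (span_basis (vbasisP _)).
apply/span_subvP => _ /(nthP 0)[j lt_j <-]; rewrite size_tuple in lt_j.
apply: seqv_sub_adjoin; apply/flatten_mapP; exists (Ordinal lt_j); first exact: mem_index_enum.
by rewrite -root_prod_XsubC -(eqp_root (rsP _)) root_minPoly.
Qed.

(** Every root of the minimal polynomial over [N] is the image of [x] under an automorphism, hence
    equals [x]; by separability the degree is then 1. *)
Lemma conormal_fixed_separable N x :
  conormal N -> fixed_aut x -> separable_element 1 x -> x \in N.
Proof.
move=> norN fix_x sep_x; have [rs Drs] := conormal_split x norN.
have sepN_x : separable_element N x := separable_elementS (sub1v N) sep_x.
have Urs : uniq rs by rewrite -separable_prod_XsubC -(eqp_separable Drs).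
have rs_x : x \in rs by rewrite -root_prod_XsubC -(eqp_root Drs) root_minPoly.
have szrs : size rs = adjoin_degree N x.
  by have /eqP := eqp_size Drs; rewrite size_minPoly size_prod_XsubC eqSS => /eqP.
rewrite -adjoin_deg_eq1 -szrs.
have all_x y : y \in rs -> y = x.
  rewrite -root_prod_XsubC -(eqp_root Drs) => y_root.
  have [p Np splitp] := conormal_splittingField norN.
  (* The [N]-embedding of [<<N; x>>] sending [x] to [y] extends to [L], a splitting field over
     [N]. *)
  have fy0 : root (map_poly \1%VF (minPoly N x)) y.
    by rewrite (kHom_poly_id (kHom1 N N)) ?minPolyOver.
  have homE := kHomExtendP (subvv N) (kHom1 N N) fy0.
  have Nx_split : splittingFieldFor <<N; x>> p {:L}.
    exact: splittingFieldForS (subv_adjoin N x) (subvf _) splitp.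
  have [g homg Dg] := kHom_extends (subv_adjoin N x) homE Np Nx_split.
  rewrite -[in RHS](fix_x g) ?kAutfE ?(kHomSl (sub1v N)) // -Dg ?memv_adjoin //.
  by rewrite (kHomExtend_val (kHom1 N N) fy0).
case: rs Urs rs_x all_x {Drs szrs} => [|y [|z rs]] //= /andP[y'rs _] _ all_x.
have yx : y = x by apply: all_x; rewrite mem_head.
have zx : z = x by apply: all_x; rewrite !inE eqxx orbT.
by rewrite yx zx mem_head in y'rs.
Qed.

End Conormal.

Theorem theorem8p4 (p : nat) (K : fieldType) (charK : p \in [pchar K])
    (L : fieldExtType K) :
  exists M : {subfield L},
    is_nor M /\ (forall x : L, x \in M <-> dif_fixed x).
Proof.
have [M MP] := fixed_separable_subfield L; exists M; split=> [|x].
  split=> [|N norN]; first exact: fixed_separable_conormal.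
  by apply/subvP => x /MP[]; apply: conormal_fixed_separable.
split=> [/MP[fix_x sep_x]|[fix_x dif_x]].
  by split=> //; apply: separable_comm_diffop.
by apply/MP; split=> //; apply: comm_diffop_separable.
Qed.
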